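(* Let $\mathrm{H}$ be a Hilbert space over $\mathbb{F} \in \{\mathbb{R}, \mathbb{C}\}$, let $d \geq 2$, let $\mathscr{A} \in \mathrm{H}^{n_1 \times \cdots \times n_d}$ with $\mathscr{A} \neq 0$, and let $\mathrm{rank}_{\mathrm{T}}(\mathscr{A}) = (r_1, \ldots, r_d)$. Then there exist, for $k = 1, \ldots, d$, index sets $I_k \subseteq [n_k]$ of cardinality $|I_k| = r_k$ and matrices $F_k \in \mathbb{F}^{n_k \times r_k}$ of full column-rank such that $$\mathscr{A} = \mathscr{A}(I_1, \ldots, I_d) \times_1 F_1 \times_2 \cdots \times_d F_d.$$
   Context: Notation: $[n] = \{1, \ldots, n\}$. $\mathrm{H}^{n_1 \times \cdots \times n_d}$ is the set of $d$-dimensional arrays (function-valued tensors) with entries in $\mathrm{H}$; $\mathrm{H}^{m \times n}$ is the set of $m \times n$ matrices with entries in $\mathrm{H}$. A matrix over $\mathrm{H}$ can be transposed and multiplied on the left and on the right by matrices over $\mathbb{F}$ by the usual formulas. For $I_k \subseteq [n_k]$, $\mathscr{A}(I_1, \ldots, I_d)$ is the subtensor of $\mathscr{A}$ with mode-$k$ indices restricted to $I_k$. Ranks of matrices over $\mathrm{H}$: the column-rank of $A \in \mathrm{H}^{m \times n}$ is the maximal number of its columns that are linearly independent over $\mathbb{F}$ as elements of $\mathrm{H}^m$; the row-rank $\mathrm{rank}_{\mathrm{r}}(A)$ is the column-rank of $A^{\top} \in \mathrm{H}^{n \times m}$. (These two need not be equal.) Unfoldings: the mode-$k$ unfolding of $\mathscr{A}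 \in \mathrm{H}^{n_1 \times \cdots \times n_d}$ is the matrix $A_{(k)} \in \mathrm{H}^{n_k \times \prod_{l \neq k} n_l}$ with entries $A_{(k)}(i_k, \overline{i_1, \ldots, i_{k-1}, i_{k+1}, \ldots, i_d}) = \mathscr{A}(i_1, \ldots, i_d)$, where the overline denotes the long (lexicographic, big-endian) index. Mode product: for $B_k \in \mathbb{F}^{m_k \times n_k}$, the mode-$k$ product $\mathscr{C} = \mathscr{A} \times_k B_k$ is the tensor over $\mathrm{H}$ whose mode-$k$ unfolding is $C_{(k)} = B_k A_{(k)}$. Tucker rank: $\mathrm{rank}_{\mathrm{T}}(\mathscr{A}) = (\mathrm{rank}_{\mathrm{r}}(A_{(1)}), \ldots, \mathrm{rank}_{\mathrm{r}}(A_{(d)}))$. *)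

(* Defs.v *)
From HB Require Import structures.
From mathcomp Require Import all_boot all_order all_algebra.
From mathcomp Require Import boolp reals topology normedtype.
From mathcomp Require Import complex.

Set Implicit Arguments.
Unset Strict Implicit.
Unset Printing Implicit Defensive.
Import Order.TTheory GRing.Theory Num.Theory.
Import numFieldNormedType.Exports.
Local Open Scope ring_scope.

Variant scalar_kind := RealScalars | ComplexScalars.

Definition scalar_field (R : realType) (s : scalar_kind) : numFieldType :=
  match s with RealScalars => R | ComplexScalars => R[i] end.

Definition scalar_field_conj (R : realType) (s : scalar_kind) :
    scalar_field R s -> scalar_field R s :=
  match s with
  | RealScalars => fun x : R => x
  | ComplexScalars => fun x : R[i] => x^*
  end.

Section Ranks.
Variables (F : fieldType) (V : lmodType F).

Definition linearly_independent (W : lmodType F) (I : finType) (v : I -> W)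
    (J : {set I}) : Prop :=
  forall c : I -> F, \sum_(j in J) c j *: v j = 0 -> forall j, j \in J -> c j = 0.

(* The library has no F-module structure on 'cV[V]_m, so a column is viewed
   in the F-module {ffun 'I_m -> V}. *)
Definition column m p (A : 'M[V]_(m, p)) (j : 'I_p) : {ffun 'I_m -> V} :=
  [ffun i => A i j].

Definition col_rank m p (A : 'M[V]_(m, p)) : nat :=
  \max_(J : {set 'I_p} | `[< linearly_independent (column A) J >]) #|J|.

Definition row_rank m p (A : 'M[V]_(m, p)) : nat := col_rank A^T.

Definition lmulmx q m p (B : 'M[F]_(q, m)) (A : 'M[V]_(m, p)) : 'M[V]_(q, p) :=
  \matrix_(i, j) \sum_l B i l *: A l j.

End Ranks.

(* The type of multi-indices (i_0, ..., i_(d-1)) with i_k < n k. *)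
Definition midx d (n : 'I_d -> nat) := {dffun forall k : 'I_d, 'I_(n k)}.

Definition tensor (V : Type) d (n : 'I_d -> nat) := {ffun midx n -> V}.

Section LongIndex.
Variables (d : nat) (k : 'I_d).

Definition unfold_width (n : 'I_d -> nat) : nat := (\prod_(l | l != k) n l)%N.

(* The product of the dimensions, other than n k, of the modes from t on. *)
Definition long_weight (n : 'I_d -> nat) (t : nat) : nat :=
  (\prod_(l | (l != k) && (t <= l)) n l)%N.

(* The 0-based big-endian index of (i_l)_(l != k): the last mode varies
   fastest. *)
Definition long_index_nat (n : 'I_d -> nat) (i : midx n) : nat :=
  (\sum_(l | l != k) i l * long_weight n l.+1)%N.

Definition long_digit_nat (n : 'I_d -> nat) (j : nat) (l : 'I_d) : nat :=
  (j %/ long_weight n l.+1 %% n l)%N.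

Lemma long_weight_rec (n : 'I_d -> nat) (l : 'I_d) :
  (long_weight n l = (if l != k then n l else 1) * long_weight n l.+1)%N.
Proof.
rewrite /long_weight; case: ifP => lk.
  rewrite (bigD1 l) /=; last by rewrite lk leqnn.
  congr (_ * _)%N; apply: eq_bigl => j.
  by rewrite ltn_neqAle [_ && (j != l)]andbAC -andbA [(l : nat) == j]eq_sym.
rewrite mul1n; apply: eq_bigl => j; case: (eqVneq j k) => //= jk.
rewrite [RHS]ltn_neqAle; case: eqP => // /val_inj lj.
by rewrite -lj lk in jk.
Qed.

Lemma long_weight_end (n : 'I_d -> nat) : long_weight n d = 1%N.
Proof.
by rewrite /long_weight big1 // => l /andP[_]; rewrite leqNgt ltn_ord.
Qed.

Let tail (n : 'I_d -> nat) (i : midx n) t :=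
  (\sum_(l | (l != k) && (t <= l)) i l * long_weight n l.+1)%N.

Let tail_rec (n : 'I_d -> nat) (i : midx n) (l : 'I_d) :
  tail i l =
    ((if l != k then i l * long_weight n l.+1 else 0) + tail i l.+1)%N.
Proof.
rewrite /tail; case: ifP => lk.
  rewrite (bigD1 l) /=; last by rewrite lk leqnn.
  congr (_ + _)%N; apply: eq_bigl => j.
  by rewrite ltn_neqAle [_ && (j != l)]andbAC -andbA [(l : nat) == j]eq_sym.
rewrite add0n; apply: eq_bigl => j; case: (eqVneq j k) => //= jk.
rewrite [RHS]ltn_neqAle; case: eqP => // /val_inj lj.
by rewrite -lj lk in jk.
Qed.

Let tail_lt (n : 'I_d -> nat) (i : midx n) t :
  (t <= d)%N -> (tail i t < long_weight n t)%N.
Proof.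
move=> td; rewrite -(subKn td); move: (leq_subr t d); move: (d - t)%N => e.
elim: e => [|e IHe] ed.
  rewrite subn0 long_weight_end /tail big1 // => l /andP[_].
  by rewrite leqNgt ltn_ord.
have lt_d : (d - e.+1 < d)%N by rewrite ltn_subrL /=; case: (d) ed.
have de : (d - e.+1).+1 = (d - e)%N by rewrite -subSn // subSS.
have IH := IHe (ltnW ed).
rewrite (tail_rec i (Ordinal lt_d)) (long_weight_rec n (Ordinal lt_d)) /= de.
case: ifP => _; last by rewrite mul1n add0n.
apply: (@leq_trans ((i (Ordinal lt_d)).+1 * long_weight n (d - e))).
  by rewrite mulSn addnC ltn_add2r.
by rewrite leq_mul2r ltn_ord orbT.
Qed.

Lemma long_index_lt (n : 'I_d -> nat) (i : midx n) :
  (long_index_nat i < unfold_width n)%N.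
Proof.
have := tail_lt i (leq0n d); rewrite /tail /long_weight.
under eq_bigl do rewrite andbT.
by under [X in (_ < X)%N -> _]eq_bigl do rewrite andbT.
Qed.

Definition long_index (n : 'I_d -> nat) (i : midx n) : 'I_(unfold_width n) :=
  Ordinal (long_index_lt i).

Lemma long_indexK (n : 'I_d -> nat) (i : midx n) (l : 'I_d) :
  l != k -> long_digit_nat n (long_index_nat i) l = i l.
Proof.
move=> lk; rewrite /long_digit_nat.
have wt_gt0 : (0 < long_weight n l.+1)%N.
  exact: leq_ltn_trans (leq0n _) (tail_lt i (ltn_ord l)).
have [q Eq] : exists q, (long_index_nat i = q * long_weight n l + tail i l)%N.
  rewrite /long_index_nat (bigID (fun j : 'I_d => (l <= j)%N)) /= -/(tail i l).
  suff /dvdnP[q ->] : (long_weight n l %|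
      \sum_(j < d | (j != k) && ~~ (l <= j)%N) i j * long_weight n j.+1)%N.
    by exists q; rewrite addnC.
  apply: dvdn_sum => j /andP[jk]; rewrite -ltnNge => jl; apply: dvdn_mull.
  rewrite [X in (_ %| X)%N]/long_weight (bigID (fun j' : 'I_d => (l <= j')%N)) /=.
  suff -> : long_weight n l =
      (\prod_(j' | (j' != k) && (j < j') && (l <= j')) n j')%N.
    exact: dvdn_mulr.
  apply: eq_bigl => j'; case: (j' != k) => //=.
  case: (leqP l j') => [lj'|_]; last by rewrite andbF.
  by rewrite (leq_trans jl lj').
rewrite Eq (long_weight_rec n l) (tail_rec i l) lk mulnA addnA -mulnDl.
by rewrite divnMDl // (divn_small (tail_lt i (ltn_ord l))) addn0 modnMDl modn_small.
Qed.

Lemma long_digit_lt (n : 'I_d -> nat) (i : 'I_(n k))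
    (j : 'I_(unfold_width n)) (l : 'I_d) : (long_digit_nat n j l < n l)%N.
Proof.
rewrite ltn_mod; have [->|lk] := eqVneq l k.
  exact: leq_ltn_trans (leq0n _) (ltn_ord i).
rewrite lt0n; apply/eqP => nl0; move: (ltn_ord j).
by rewrite [X in (_ < X)%N](bigD1 l) //= nl0 mul0n ltn0.
Qed.

(* The multi-index whose mode-k component is i and whose remaining components
   have long index j. *)
Definition unfold_midx (n : 'I_d -> nat) (i : 'I_(n k))
    (j : 'I_(unfold_width n)) : midx n :=
  [ffun l => dfwith (fun l => Ordinal (long_digit_lt i j l)) i l].

Lemma unfold_midxK (n : 'I_d -> nat) (i : midx n) :
  unfold_midx (i k) (long_index i) = i.
Proof.
apply/ffunP => l; rewrite ffunE; have [<-|kl] := eqVneq k l.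
  by rewrite dfwith_in.
by rewrite dfwith_out //; apply/val_inj => /=; rewrite long_indexK // eq_sym.
Qed.

Lemma unfold_midx_in (n : 'I_d -> nat) (i : 'I_(n k))
    (j : 'I_(unfold_width n)) : unfold_midx i j k = i.
Proof. by rewrite ffunE dfwith_in. Qed.

Lemma long_index_unfold_midx (n : 'I_d -> nat) (i : 'I_(n k))
    (j : 'I_(unfold_width n)) : long_index (unfold_midx i j) = j.
Proof.
pose f (x : midx n) := (x k, long_index x).
have f_inj : injective f.
  move=> x y fxy; rewrite -[x]unfold_midxK -[y]unfold_midxK.
  by congr unfold_midx; [exact: (congr1 fst fxy) | exact: (congr1 snd fxy)].
have : (#|{: 'I_(n k) * 'I_(unfold_width n)}| <= #|{: midx n}|)%N.
  rewrite card_prod !card_ord card_dep_ffun foldrE big_map big_enum /=.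
  rewrite (bigD1 k) //= card_ord leq_mul2l; apply/orP; right.
  by rewrite leq_eqVlt; apply/orP; left; apply/eqP/eq_bigr => l _; rewrite card_ord.
move=> /(inj_card_bij f_inj)[g _ fg].
have fij := fg (i, j).
have -> : unfold_midx i j = g (i, j).
  rewrite -[RHS]unfold_midxK; congr unfold_midx.
    exact/esym/(congr1 fst fij).
  exact/esym/(congr1 snd fij).
exact: (congr1 snd fij).
Qed.

End LongIndex.

Section Tensor.
Variables (F : fieldType) (V : lmodType F) (d : nat).

Definition unfolding (k : 'I_d) (n : 'I_d -> nat) (A : tensor V n) :
    'M[V]_(n k, unfold_width k n) :=
  \matrix_(i, j) A (unfold_midx i j).

Definition folding (k : 'I_d) (n : 'I_d -> nat)
    (M : 'M[V]_(n k, unfold_width k n)) : tensor V n :=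
  [ffun i : midx n => M (i k) (long_index k i)].

Lemma unfoldE (k : 'I_d) (n : 'I_d -> nat) (A : tensor V n) (i : midx n) :
  unfolding k A (i k) (long_index k i) = A i.
Proof. by rewrite mxE unfold_midxK. Qed.

Lemma foldK (k : 'I_d) (n : 'I_d -> nat)
    (M : 'M[V]_(n k, unfold_width k n)) : unfolding k (folding M) = M.
Proof.
by apply/matrixP => i j; rewrite mxE ffunE unfold_midx_in long_index_unfold_midx.
Qed.

Definition tucker_rank (n : 'I_d -> nat) (A : tensor V n) : d.-tuple nat :=
  [tuple row_rank (unfolding k A) | k < d].

(* enum_val enumerates I k in increasing order. *)
Definition subtensor (n : 'I_d -> nat) (A : tensor V n)
    (I : forall k, {set 'I_(n k)}) : tensor V (fun k => #|I k|) :=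
  [ffun i : midx (fun k => #|I k|) =>
     A [ffun k => enum_val (i k) : 'I_(n k)]].

Definition cast_tensor (m n : 'I_d -> nat) (e : forall k, m k = n k)
    (A : tensor V m) : tensor V n :=
  [ffun i : midx n => A [ffun k => cast_ord (esym (e k)) (i k)]].

Lemma unfold_width_eq (k : 'I_d) (m n : 'I_d -> nat) :
  (forall l, l != k -> m l = n l) -> unfold_width k m = unfold_width k n.
Proof. exact: eq_bigr. Qed.

(* The mode-k product; the new shape n agrees with m in the other modes, but
   not definitionally, whence the cast. *)
Definition mode_product (k : 'I_d) (m n : 'I_d -> nat)
    (e : forall l, l != k -> m l = n l)
    (A : tensor V m) (B : 'M[F]_(n k, m k)) : tensor V n :=
  folding (castmx (erefl, unfold_width_eq e) (lmulmx B (unfolding k A))).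

Lemma unfold_mode_product (k : 'I_d) (m n : 'I_d -> nat)
    (e : forall l, l != k -> m l = n l)
    (A : tensor V m) (B : 'M[F]_(n k, m k)) :
  unfolding k (mode_product e A B) =
  castmx (erefl, unfold_width_eq e) (lmulmx B (unfolding k A)).
Proof. exact: foldK. Qed.

(* The shape after the first t of the products A x_1 B_1 x_2 ... x_d B_d. *)
Definition partial_shape (m n : 'I_d -> nat) (t : nat) (k : 'I_d) : nat :=
  if (k < t)%N then n k else m k.

Lemma partial_shapeS_neq (m n : 'I_d -> nat) (k l : 'I_d) :
  l != k -> partial_shape m n k l = partial_shape m n k.+1 l.
Proof.
by move=> lk; rewrite /partial_shape ltnS [(l <= k)%N]leq_eqVlt val_eqE (negPf lk).
Qed.

Lemma partial_shape_lt (m n : 'I_d -> nat) t (k : 'I_d) :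
  (k < t)%N -> n k = partial_shape m n t k.
Proof. by rewrite /partial_shape => ->. Qed.

Lemma partial_shape_ge (m n : 'I_d -> nat) t (k : 'I_d) :
  (t <= k)%N -> m k = partial_shape m n t k.
Proof. by rewrite /partial_shape ltnNge => ->. Qed.

(* ((A x_1 B_1) x_2 B_2 ...) x_t B_t. *)
Fixpoint partial_products (m n : 'I_d -> nat) (A : tensor V m)
    (B : forall k, 'M[F]_(n k, m k)) (t : nat) :
    (t <= d)%N -> tensor V (partial_shape m n t) :=
  match t with
  | 0 => fun _ => cast_tensor (fun k => partial_shape_ge m n (leq0n k)) A
  | t'.+1 => fun td =>
      let k : 'I_d := Ordinal td in
      mode_product (k := k) (@partial_shapeS_neq m n k)
        (partial_products A B (ltnW td))
        (castmx (partial_shape_lt m n (ltnSn k),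
                 partial_shape_ge m n (leqnn k)) (B k))
  end.

Definition mode_products (m n : 'I_d -> nat) (A : tensor V m)
    (B : forall k, 'M[F]_(n k, m k)) : tensor V n :=
  cast_tensor (fun k => esym (partial_shape_lt m n (ltn_ord k)))
    (partial_products A B (leqnn d)).

End Tensor.

(* Main.v *)
(* Each row of the mode-k unfolding is a combination of the rows in a maximal
   independent set I_k, with coefficients collected in F_k; rows in I_k get unit
   coefficient vectors, so F_k contains an identity block. Hence expanding mode k
   recovers A from its restriction to I_k in that mode, and the mode products
   undo the d restrictions one at a time. *)
Require Import Defs.
From mathcomp Require Import all_boot all_order all_algebra.
From mathcomp Require Import reals topology normedtype.
From mathcomp Require Import boolp.
Import GRing.Theory Num.Theory.
Local Open Scope ring_scope.

Set Implicit Arguments.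
Unset Strict Implicit.
Unset Printing Implicit Defensive.

Section Independence.
Variables (F : fieldType) (W : lmodType F) (I : finType) (v : I -> W).

Lemma linearly_independent0 : linearly_independent v set0.
Proof. by move=> c _ j; rewrite in_set0. Qed.

(** A nontrivial relation on [i |: J] must involve [v i], since otherwise it would be a relation on
    [J]; dividing by the coefficient of [v i] solves for it. *)
Lemma dependent_span (J : {set I}) (i : I) :
  linearly_independent v J -> i \notin J ->
  ~ linearly_independent v (i |: J) ->
  exists c : I -> F, v i = \sum_(j in J) c j *: v j.
Proof.
move=> indJ iJ; apply: contra_notP => nspan c.
rewrite big_setU1 //= => c0.
have ci0 : c i = 0.
  apply/eqP/negPn/negP => ci; apply: nspan.
  exists (fun j => - ((c i)^-1 * c j)).
  apply: (scalerI ci); rewrite scaler_sumr.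
  move/eqP: c0; rewrite addr_eq0 => /eqP ->; rewrite -sumrN.
  by apply: eq_bigr => j _; rewrite scalerA mulrN mulrA divff // mul1r scaleNr.
move: c0; rewrite ci0 scale0r add0r => /indJ cJ j.
by rewrite in_setU1 => /orP[/eqP -> //|/cJ].
Qed.

End Independence.

Section RowBasis.
Variables (F : fieldType) (V : lmodType F).

Lemma col_rank_attained m p (A : 'M[V]_(m, p)) :
  exists J : {set 'I_p}, [/\ #|J| = col_rank A,
    linearly_independent (column A) J
    & forall j, j \notin J -> ~ linearly_independent (column A) (j |: J)].
Proof.
have [|J indJ maxJ] := @eq_bigmax_cond _
    [pred J : {set 'I_p} | `[< linearly_independent (column A) J >]]
    (fun J => #|J|).
  (* A maximum is attained only over a nonempty family; the empty set is a member. *)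
  apply/card_gt0P; exists set0; apply/asboolP; exact: linearly_independent0.
exists J; split=> [||j jJ indjJ].
- exact: esym.
- exact/asboolP.
have : (#|j |: J| <= col_rank A)%N.
  by apply: leq_bigmax_cond; apply/asboolP.
by rewrite /col_rank maxJ cardsU1 jJ ltnn.
Qed.

Lemma row_rank_factor m p (A : 'M[V]_(m, p)) :
  exists (I : {set 'I_m}) (B : 'M[F]_(m, #|I|)),
    [/\ #|I| = row_rank A, \rank B = #|I|
      & forall i j, A i j = \sum_l B i l *: A (enum_val l) j].
Proof.
have [I [cardI indI maxI]] := col_rank_attained A^T.
(* For [i] in [I] the coefficients are prescribed as Kronecker deltas, which makes the identity
   block of [B] explicit. *)
have /choice [c cP] (i : 'I_m) : exists c : 'I_m -> F,
    (i \in I -> forall j, c j = (j == i)%:R) /\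
    column A^T i = \sum_(j in I) c j *: column A^T j.
  have [iI|iI] := boolP (i \in I); last first.
    have [c cE] := dependent_span indI iI (maxI i iI).
    by exists c.
  exists (fun j => (j == i)%:R); split=> //.
  rewrite (bigD1 i) //= eqxx scale1r big1 ?addr0 // => j /andP[_ /negPf ->].
  by rewrite scale0r.
pose B : 'M[F]_(m, #|I|) := \matrix_(i, l) c i (enum_val l).
exists I, B; split=> //.
  apply/eqP; rewrite eqn_leq rank_leq_col /=.
  (* The identity block bounds the rank of [B] from below. *)
  have rowsubB : rowsub enum_val B = 1%:M.
    apply/matrixP => k l; rewrite !mxE (cP _).1 ?enum_valP //.
    by rewrite (inj_eq enum_val_inj) eq_sym.
  rewrite -[X in (X <= _)%N](mxrank1 F) -rowsubB.
  exact: mxrankS (rowsub_sub _ _).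
move=> i j; have /ffunP/(_ j) := (cP i).2.
rewrite sum_ffunE ffunE mxE => ->; rewrite big_enum_val.
by apply: eq_bigr => l _; rewrite !ffunE !mxE.
Qed.

End RowBasis.

Section ModeProducts.
Variables (F : fieldType) (V : lmodType F) (d : nat).

Lemma long_weight_eq (k : 'I_d) (m n : 'I_d -> nat) t :
  (forall l, l != k -> m l = n l) -> long_weight k m t = long_weight k n t.
Proof. by move=> e; apply: eq_bigr => l /andP[/e]. Qed.

(** Decoding a long index never uses the size of mode [k], so equal long indices have equal digits
    in shapes that differ only in that mode. *)
Lemma val_unfold_midx_long_index (k : 'I_d) (m n : 'I_d -> nat)
    (e : forall l, l != k -> m l = n l) (x : 'I_(m k)) (i : midx n)
    (j : 'I_(unfold_width k m)) (l : 'I_d) :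
  j = long_index k i :> nat -> l != k -> unfold_midx x j l = i l :> nat.
Proof.
move=> ji lk; rewrite ffunE dfwith_out 1?eq_sym //= ji /=.
by rewrite /long_digit_nat (long_weight_eq _ e) e // -[RHS](long_indexK i lk).
Qed.

Lemma mode_productE (k : 'I_d) (m n : 'I_d -> nat)
    (e : forall l, l != k -> m l = n l) (A : tensor V m)
    (B : 'M[F]_(n k, m k)) (i : midx n) :
  mode_product e A B i = \sum_l B (i k) l *:
    A (unfold_midx l (cast_ord (esym (unfold_width_eq e)) (long_index k i))).
Proof.
rewrite ffunE castmxE mxE /=; apply: eq_bigr => l _.
by rewrite mxE cast_ord_id.
Qed.

Definition midx_set (n : 'I_d -> nat) (i : midx n) (k : 'I_d) (x : 'I_(n k)) :
    midx n := [ffun l => dfwith (i : forall l, 'I_(n l)) x l].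

Lemma midx_set_in (n : 'I_d -> nat) (i : midx n) (k : 'I_d) (x : 'I_(n k)) :
  midx_set i x k = x.
Proof. by rewrite ffunE dfwith_in. Qed.

Lemma midx_set_out (n : 'I_d -> nat) (i : midx n) (k l : 'I_d) (x : 'I_(n k)) :
  l != k -> midx_set i x l = i l.
Proof. by move=> lk; rewrite ffunE dfwith_out // eq_sym. Qed.

Variables (m n : 'I_d -> nat) (A : tensor V n).
Variables (g : forall k, 'I_(m k) -> 'I_(n k)) (B : forall k, 'M[F]_(n k, m k)).
Hypothesis expandA : forall k i,
  A i = \sum_l B k (i k) l *: A (midx_set i (g l)).

Let restrA : tensor V m := [ffun i : midx m => A [ffun k => g (i k)]].

(* The multi-indices i and j live in different shapes, so the agreement of
   their components is expressed on values rather than through casts. *)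
Lemma partial_products_restr t (td : (t <= d)%N)
    (i : midx (partial_shape m n t)) (j : midx n) :
  (forall k : 'I_d, (k < t)%N -> i k = j k :> nat) ->
  (forall (k : 'I_d) (p : 'I_(m k)),
     (t <= k)%N -> p = i k :> nat -> j k = g p) ->
  partial_products restrA B td i = A j.
Proof.
elim: t td i j => [|t IHt] td i j ij_lt ij_ge /=.
  rewrite !ffunE; congr (A _); apply/ffunP => k; rewrite !ffunE.
  exact/esym/ij_ge.
rewrite mode_productE; set k := Ordinal td.
(* The last product and the expansion of [A] in mode [t] are matched term by term. *)
rewrite (expandA k j).
have mk : m k = partial_shape m n t k by exact: partial_shape_ge.
(* Mode [t] still has its restricted size [m k] before this product. *)
rewrite (reindex (cast_ord mk)) /=; last first.
  by exists (cast_ord (esym mk)) => x _; rewrite ?cast_ordK ?cast_ordKV.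
apply: eq_bigr => l _; rewrite castmxE /=; congr (_ *: _).
  by congr (B k _ _); apply: val_inj => //=; apply: ij_lt => /=.
(* The induction hypothesis is used at [midx_set j (g l)]: mode [t] now counts among the restricted
   modes, and its component [g l] has the required form. *)
apply: IHt => [k' k't|k' p k't].
  have k'k : k' != k by rewrite -val_eqE /= ltn_eqF.
  rewrite (@val_unfold_midx_long_index k _ _ (@partial_shapeS_neq _ m n k) _ i) //.
  by rewrite midx_set_out //; apply: ij_lt; apply: ltnW.
have [kk'|k'k] := eqVneq k' k.
  move: p; rewrite {}kk' => p.
  rewrite midx_set_in unfold_midx_in /= => pl.
  by congr g; apply: val_inj; rewrite /= pl.
rewrite (@val_unfold_midx_long_index k _ _ (@partial_shapeS_neq _ m n k) _ i) //.
rewrite midx_set_out //; apply: ij_ge.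
by rewrite ltn_neqAle k't andbT eq_sym -[t]/(val k) val_eqE.
Qed.

Lemma mode_products_restr : mode_products restrA B = A.
Proof.
(* At [t = d] all modes are expanded: both multi-indices have the same values, and the condition on
   restricted modes is vacuous. *)
apply/ffunP => i; rewrite ffunE; apply: partial_products_restr => k.
  by rewrite ffunE.
by move=> p; rewrite leqNgt ltn_ord.
Qed.

End ModeProducts.

Theorem proposition3p3 (R : realType) (s : scalar_kind)
  (H : completeNormedModType (scalar_field R s))
  (inner : {dot H for @scalar_field_conj R s})
  (norm_inner : forall x : H, `|x| ^+ 2 = inner x x)
  (d : nat) (hd : (2 <= d)%N) (n : 'I_d -> nat)
  (A : tensor H n) (hA : A != 0)
  (r : d.-tuple nat) (hr : tucker_rank A = r) :
  exists (I : forall k : 'I_d, {set 'I_(n k)})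
         (F : forall k : 'I_d, 'M[scalar_field R s]_(n k, #|I k|)),
    [/\ forall k, #|I k| = tnth r k,
        forall k, \rank (F k) = #|I k|
      & A = mode_products (subtensor A I) F].
Proof.
pose ex k := cid (row_rank_factor (unfolding k A)).
pose I k := projT1 (ex k).
pose exB k := cid (projT2 (ex k)).
pose F k : 'M_(n k, #|I k|) := projT1 (exB k).
have IF k : [/\ #|I k| = row_rank (unfolding k A), \rank (F k) = #|I k|
    & forall i j, unfolding k A i j
        = \sum_l F k i l *: unfolding k A (enum_val l) j].
  exact: projT2 (exB k).
exists I, F; split=> [k|k|].
- by rewrite -hr tnth_mktuple; case: (IF k).
- by case: (IF k).
(* With [g] the enumeration of [I k], the restricted tensor is [subtensor A I]; what remains is the
   row expansion of each unfolding, read entrywise. *)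
apply/esym; apply: (mode_products_restr (g := fun k l => enum_val l)) => k i.
have [_ _ FE] := IF k; rewrite -(unfoldE k) FE.
apply: eq_bigr => l _; congr (_ *: _); rewrite mxE; congr (A _).
apply/ffunP => l'; have [->|lk] := eqVneq l' k.
  by rewrite unfold_midx_in midx_set_in.
rewrite midx_set_out //; apply: val_inj.
exact: val_unfold_midx_long_index.
Qed.
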